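(* Let $\lambda=\lim_{n\to\infty}\lambda_n$ be the cardinal defined by $\lambda_0=\omega_0$ and $\lambda_{n+1}=2^{\lambda_n}$ for $n\ge 0$. Let $X$ be a Banach space with density $\operatorname{dens}(X)\ge\lambda$ which admits a coarse embedding or a uniform embedding into $c_0(\Gamma)$ for some set $\Gamma$. Then $X$ fails to have nontrivial cotype, i.e. $X$ contains $\ell_\infty^n$ $C$-uniformly for some $C>1$ (equivalently, for every $C>1$).
   Context: $\operatorname{dens}(X)$ is the smallest cardinality of a norm-dense subset of $X$. For a set $\Gamma$ of arbitrary cardinality, $c_0(\Gamma)$ is the Banach space of scalar functions $x$ on $\Gamma$ such that $\{\gamma:|x(\gamma)|>\varepsilon\}$ is finite for all $\varepsilon>0$, with the sup norm. For a map $f:M_1\to M_2$ between metric spaces $(M_1,d_1)$, $(M_2,d_2)$ and $t\ge 0$ put $w_f(t)=\sup\{d_2(f(x),f(y)): x,y\in M_1,\ d_1(x,y)\le t\}$ and $\rho_f(t)=\inf\{d_2(f(x),f(y)): x,y\in M_1,\ d_1(x,y)\ge t\}$. The map $f$ is a uniform embedding if $\lim_{t\to0}w_f(t)=0$ and $\rho_f(t)>0$ for every $t>0$. It is a coarse embedding if $w_f(t)<\infty$ for all $0<t<\infty$ and $\lim_{t\to\infty}\rho_f(t)=\infty$. The embeddings are not assumed linear. $X$ contains $\ell_\infty^n$ $C$-uniformly if for every $n\in\mathbb N$ there is an $n$-dimensional subspace $E$ of $X$ and a linear isomorphism $T:\ell_\infty^n\to E$ with $\|T\|\,\|T^{-1}\|\le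 C$. Nontrivial cotype means cotype $q$ for some $q<\infty$. *)

(* Defs.v *)
From HB Require Import structures.
From mathcomp Require Import all_boot all_order all_algebra.
From mathcomp Require Import complex.
From mathcomp Require Import all_classical all_reals all_analysis.

Set Implicit Arguments.
Unset Strict Implicit.
Unset Printing Implicit Defensive.

Import Order.TTheory GRing.Theory Num.Theory.
Import numFieldNormedType.Exports.

Local Open Scope classical_set_scope.
Local Open Scope ring_scope.

(* Banach spaces are over the real or over the complex numbers. *)
Variant scalar_kind := RealScalars | ComplexScalars.

Definition scalars (R : realType) (s : scalar_kind) : numFieldType :=
  match s with
  | RealScalars => R
  | ComplexScalars => R[i]
  end.

Definition real_part (R : realType) (s : scalar_kind) : scalars R s -> R :=
  match s with
  | RealScalars => fun z : R => z
  | ComplexScalars => fun z : R[i] => complex.Re z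
  end.

(* The library norm of a vector over the complex scalars is itself a (real)
   complex number; [nrm] is the same norm with values in [R]. *)
Definition nrm (R : realType) (s : scalar_kind)
  (V : normedZmodType (scalars R s)) (x : V) : R := real_part `|x|.

Definition nrm_dist (R : realType) (s : scalar_kind)
  (V : normedZmodType (scalars R s)) (x y : V) : R := nrm (x - y).

(* [beth n] has cardinality lambda_n. The lambda_n are strictly increasing
   infinite cardinals, so that their limit (supremum) is also the cardinality of
   their disjoint union [beth_omega]. *)
Fixpoint beth (n : nat) : Type :=
  match n with
  | 0%N => nat
  | m.+1 => set (beth m)
  end.

Definition beth_omega : Type := {n : nat & beth n}.

(* kappa <= dens(X), where kappa is the cardinality of [K]: every norm-dense set,
   in particular one of smallest cardinality, has cardinality at least kappa. *)
Definition dens_ge (K : Type) (X : topologicalType) : Prop :=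
  forall D : set X, dense D -> ([set: K] #<= D)%card.

Record c0 (R : realType) (s : scalar_kind) (Gamma : Type) := C0 {
  c0_fun :> Gamma -> scalars R s ;
  c0_vanish : forall e : R, 0 < e ->
    finite_set [set g | e < nrm (c0_fun g : scalars R s)] }.

(* The metric of the sup norm; the set is bounded above, and the supremum is 0
   if [Gamma] is empty. *)
Definition c0_dist (R : realType) (s : scalar_kind) (Gamma : Type)
  (x y : c0 R s Gamma) : R :=
  sup (range (fun g => nrm (x g - y g : scalars R s))).

Section moduli.
Context (R : realType) (M1 M2 : Type).
Variables (d1 : M1 -> M1 -> R) (d2 : M2 -> M2 -> R) (f : M1 -> M2).

Definition expansion_modulus (t : R) : \bar R :=
  ereal_sup [set (d2 (f p.1) (f p.2))%:E | p in [set p | d1 p.1 p.2 <= t]].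

Definition compression_modulus (t : R) : \bar R :=
  ereal_inf [set (d2 (f p.1) (f p.2))%:E | p in [set p | t <= d1 p.1 p.2]].

Definition uniform_embedding : Prop :=
  (expansion_modulus t @[t --> 0^'+] --> 0%E) /\
  (forall t : R, 0 < t -> (0 < compression_modulus t)%E).

Definition coarse_embedding : Prop :=
  (forall t : R, 0 < t -> (expansion_modulus t < +oo)%E) /\
  (compression_modulus t @[t --> +oo] --> +oo%E).

End moduli.

(* Operator norm of a linear map [T] defined on the subspace [D] of [V]. *)
Definition op_norm (R : realType) (s : scalar_kind)
  (V W : normedZmodType (scalars R s)) (D : set V) (T : V -> W) : \bar R :=
  ereal_sup [set (nrm (T x))%:E | x in [set x | D x /\ nrm x <= 1]].

(* The norm of ['rV_n] is the sup norm, so this space is l_infty^n. The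
   n-dimensional subspace is [E = range T], and [S] restricted to [E] is the
   inverse of [T]; values of [S] outside [E] are irrelevant. *)
Definition contains_linfty_uniformly (R : realType) (s : scalar_kind)
  (X : normedModType (scalars R s)) (C : R) : Prop :=
  forall n : nat,
    exists (T : {linear 'rV[scalars R s]_n -> X}) (S : X -> 'rV[scalars R s]_n),
      cancel T S /\ (op_norm setT T * op_norm (range T) S <= C%:E)%E.

(* The Rademacher average is taken in L_2; by the Khintchine-Kahane inequality any
   other moment gives the same notion. *)
Definition has_cotype (R : realType) (s : scalar_kind)
  (X : normedModType (scalars R s)) (q : R) : Prop :=
  exists2 C : R, 0 < C &
    forall (n : nat) (x : 'I_n -> X),
      (\sum_(i < n) nrm (x i) `^ q) `^ q^-1 <=
      C * Num.sqrt ((2 ^+ n)^-1 *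
            \sum_(eps : {ffun 'I_n -> bool})
               nrm (\sum_(i < n) (-1) ^+ eps i *: x i) ^+ 2).

Definition nontrivial_cotype (R : realType) (s : scalar_kind)
  (X : normedModType (scalars R s)) : Prop :=
  exists2 q : R, 2 <= q & has_cotype X q.

(* Main.v *)
Require Import Defs.
From HB Require Import structures.
From mathcomp Require Import all_boot all_order all_algebra.
From mathcomp Require Import complex.
From mathcomp Require Import all_classical all_reals all_analysis.
From mathcomp Require Import lra.

Set Implicit Arguments.
Unset Strict Implicit.
Unset Printing Implicit Defensive.

Import Order.TTheory GRing.Theory Num.Theory.
Import numFieldNormedType.Exports.

Local Open Scope classical_set_scope.
Local Open Scope ring_scope.

(** The proof turns the embedding [f : X -> c0(Gamma)], for every [n], into [n]
vectors of norm at least 1 all of whose signed sums have norm at most [M], with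
[M] independent of [n].

Since [dens X >= beth_omega], the unit ball contains, for each [k], a
1/2-separated family indexed by [beth k.+1] ([ball_separated]): if a maximal
1/2-separated family were smaller, its dyadic combinations would form a dense
set that is too small. Choosing one member of each of the first [n] families
gives a point [a] of a product [B 0 * ... * B (n-1)] of sets of rapidly growing
cardinality, and hence the signed sums [sum_i +-x_i(a_i)]. Changing one
coordinate moves each signed sum by at most 2, so after scaling it moves the
image under [f] by at most a fixed [L].

The heart is [distinct_pair_close]: any map from such a product to a [c0] space
that moves by at most [L] when one coordinate changes takes two points that
differ in every coordinate to points at distance about [4 L], whatever [n] is.
It is a pigeonhole argument by induction on [n], which uses only that a vector of
[c0] has finitely many coordinates larger than [L] and that the last factor has
more elements than there are pairs of points of the previous factors together
with finite sequences of integers. Applying it to all [2 ^ n] sign patterns at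
once, that is, to a single map into [c0(signs * Gamma)], gives two points whose
signed sums are mapped to within [5 L] of each other, so that these signed sums
are themselves at bounded distance ([embedding_scale] finds the scale on which
this works, in the coarse and in the uniform case alike). The differences of
the coordinates of the two points are, up to a factor, the required vectors
([bounded_signs]).

Such vectors contradict cotype [q], since [n ^ (1/q)] is unbounded
([signs_dominated_no_cotype]). By convexity, their linear combinations with
coefficients of modulus at most 1 are bounded as well
([signs_dominated_sup]), and James' blocking argument improves the constant of
these combinations to any [C > 1] ([james_distortion]). *)

(** * Real-valued norms over real or complex scalars *)

Definition of_real (R : realType) (s : scalar_kind) : R -> scalars R s :=
  match s with
  | RealScalars => fun r : R => r
  | ComplexScalars => fun r : R => Complex r 0
  end.

Section scalars.
Context (R : realType) (s : scalar_kind).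
Local Notation K := (scalars R s).
Local Notation "r %:K" := (@of_real R s r) (at level 2, format "r %:K").

Lemma of_realD (a b : R) : (a + b)%:K = a%:K + b%:K.
Proof. by case: s => //=; rewrite -[RHS]/(Complex _ _) /= addr0. Qed.

Lemma of_realM (a b : R) : (a * b)%:K = a%:K * b%:K.
Proof.
case: s => //=; rewrite -[RHS]/(Complex _ _) /=.
by rewrite !(mulr0, mul0r, subr0, addr0).
Qed.

Lemma of_realB (a b : R) : (a - b)%:K = a%:K - b%:K.
Proof. by apply/eqP; rewrite eq_sym subr_eq -of_realD subrK. Qed.

Lemma of_real0 : 0%:K = 0.
Proof. by case: s. Qed.

Lemma of_real1 : 1%:K = 1.
Proof. by case: s. Qed.

Lemma of_realK (a : R) : @real_part R s a%:K = a.
Proof. by case: s. Qed.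

Lemma of_real_inj : injective (@of_real R s).
Proof. by move=> a b ab; rewrite -[a]of_realK ab of_realK. Qed.

Lemma of_real_le (a b : R) : (a%:K <= b%:K) = (a <= b).
Proof. by case: s => //=; rewrite lecE /= eqxx. Qed.

Lemma of_real_lt (a b : R) : (a%:K < b%:K) = (a < b).
Proof. by rewrite !lt_neqAle of_real_le (inj_eq of_real_inj). Qed.

Lemma of_real_norm (a : R) : `|a%:K| = `|a|%:K.
Proof. by case: s => //=; rewrite normc_def /= expr0n addr0 sqrtr_sqr. Qed.

Lemma of_real_ge0 (z : K) : 0 <= z -> z = (@real_part R s z)%:K.
Proof.
by case: s z => //= -[a b]; rewrite lecE /= => /andP[/eqP -> _].
Qed.

Section norm.
Context (V : normedZmodType K).
Implicit Types x y : V.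

Lemma nrmE x : `|x| = (nrm x)%:K.
Proof. exact: of_real_ge0. Qed.

Lemma nrm_ge0 x : 0 <= nrm x.
Proof. by rewrite -of_real_le of_real0 -nrmE. Qed.

Lemma nrmD x y : nrm (x + y) <= nrm x + nrm y.
Proof. by rewrite -of_real_le of_realD -!nrmE ler_normD. Qed.

Lemma nrmN x : nrm (- x) = nrm x.
Proof. by rewrite /nrm normrN. Qed.

Lemma nrmB x y : nrm (x - y) <= nrm x + nrm y.
Proof. by rewrite -(nrmN y) nrmD. Qed.

Lemma nrmC x y : nrm (x - y) = nrm (y - x).
Proof. by rewrite -nrmN opprB. Qed.

Lemma nrm0 : nrm (0 : V) = 0.
Proof. by apply: of_real_inj; rewrite -nrmE normr0 of_real0. Qed.

Lemma nrm0_eq0 x : nrm x = 0 -> x = 0.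
Proof. by move=> x0; apply/normr0_eq0; rewrite nrmE x0 of_real0. Qed.

End norm.

Lemma nrm_of_real (a : R) : nrm (a%:K : K) = `|a|.
Proof. by apply: of_real_inj; rewrite -nrmE of_real_norm. Qed.

Lemma nrm_sign (b : bool) : nrm ((-1) ^+ b : K) = 1.
Proof.
by apply: of_real_inj; rewrite -nrmE of_real1 normr_sign.
Qed.

Lemma nrmM (a b : K) : nrm (a * b) = nrm a * nrm b.
Proof. by apply: of_real_inj; rewrite of_realM -!nrmE normrM. Qed.

Section normed_module.
Context (V : normedModType K).

Lemma nrmZ (a : K) (x : V) : nrm (a *: x) = nrm a * nrm x.
Proof. by apply: of_real_inj; rewrite of_realM -!nrmE normrZ. Qed.

Lemma nrmZ_sign (b : bool) (x : V) : nrm ((-1) ^+ b *: x) = nrm x.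
Proof. by rewrite nrmZ nrm_sign mul1r. Qed.

End normed_module.

(** The scalar [j] is 0 in the real case and the imaginary unit in the complex
case; this lets real and complex scalars be treated by one argument. *)
Lemma scalar_decomp : exists j : K, nrm j <= 1 /\
  forall z : K, exists a b : R,
    [/\ z = a%:K + j * b%:K, `|a| <= nrm z & `|b| <= nrm z].
Proof.
case: s.
  exists 0; split=> [|z]; first by rewrite /nrm normr0.
  by exists z, 0; rewrite /= mul0r addr0 normr0; split=> //; exact: (normr_ge0 z).
have nrm_complex (z : R[i]) : nrm (z : scalars R ComplexScalars) =
    Num.sqrt (complex.Re z ^+ 2 + complex.Im z ^+ 2).
  by rewrite -[LHS]/(complex.Re `|z|) normc_def.
exists (Complex 0 1); split=> [|[a b]].
  by rewrite nrm_complex /= expr0n expr1n add0r sqrtr1.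
exists a, b; rewrite nrm_complex /=; split.
- by rewrite -[RHS]/(Complex _ _) /= !(mulr0, mul0r, mul1r, subr0, add0r, addr0).
- by rewrite -sqrtr_sqr ler_sqrt ?lerDl ?addr_ge0 ?sqr_ge0.
- by rewrite -sqrtr_sqr ler_sqrt ?lerDr ?addr_ge0 ?sqr_ge0.
Qed.

(** The plane is cut into countably many cells of diameter at most [eta], which
are the colours of the values in the pigeonhole argument below. *)
Lemma scalar_rounding (eta : R) : 0 < eta ->
  exists r : K -> int * int, forall z w, r z = r w -> nrm (z - w) <= eta.
Proof.
move=> eta0; have [j [j1 dec]] := scalar_decomp.
have /choice[d dP] : forall z, exists d : R * R, z = d.1%:K + j * d.2%:K.
  by move=> z; have [a [b [zab _ _]]] := dec z; exists (a, b).
pose t := eta / 2; have t0 : 0 < t by rewrite divr_gt0.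
exists (fun z => (Num.floor ((d z).1 / t), Num.floor ((d z).2 / t))) => z w [e1 e2].
have close (a b : R) : Num.floor (a / t) = Num.floor (b / t) -> `|a - b| <= t.
  move=> ab.
  have /andP[a1 a2] := floor_itv (a / t); have /andP[b1 b2] := floor_itv (b / t).
  rewrite -[leRHS]mul1r -ler_pdivrMr// -[X in _ / X](gtr0_norm t0) -normf_div.
  by rewrite mulrBl ler_norml; move: a1 a2 b1 b2; rewrite ab !intrD; lra.
have -> : z - w = ((d z).1 - (d w).1)%:K + j * ((d z).2 - (d w).2)%:K.
  by rewrite {1}(dP z) {1}(dP w) !of_realB mulrBr opprD addrACA.
rewrite (le_trans (nrmD _ _))// (splitr eta) lerD//.
  by rewrite nrm_of_real close.
by rewrite nrmM nrm_of_real -[leRHS]mul1r ler_pM ?nrm_ge0 ?close.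
Qed.

End scalars.

(** * Cardinal arithmetic of the beth numbers *)

Definition injects (A B : Type) : Prop := exists f : A -> B, injective f.

Lemma injects_trans (A B C : Type) : injects A B -> injects B C -> injects A C.
Proof. by move=> [f fI] [g gI]; exists (g \o f); apply: inj_comp. Qed.

Lemma injects_pair (A B C D : Type) :
  injects A B -> injects C D -> injects (A * C) (B * D).
Proof.
move=> [f fI] [g gI]; exists (fun p => (f p.1, g p.2)).
by move=> -[a c] [a' c'] /= [/fI-> /gI->].
Qed.

Lemma injects_set (A B : Type) : injects A B -> injects (set A) (set B).
Proof.
move=> [f fI]; exists (fun S => f @` S) => S T ST; apply/seteqP.
have im (U : set A) x : U x <-> (f @` U) (f x).
  by split=> [Ux|[y Uy /fI <-]//]; exists x.
by split=> x; rewrite (im S) (im T) ST.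
Qed.

Lemma injects_set1 (A : Type) : injects A (set A).
Proof. by exists (fun a => [set a]) => a b ab; have : [set b] a by rewrite -ab. Qed.

Lemma injects_countType (C : countType) : injects C nat.
Proof. by exists pickle; apply: (pcan_inj pickleK). Qed.

Lemma cantor (A : Type) : ~ injects (set A) A.
Proof.
move=> [f fI]; pose S := [set a | exists2 T, a = f T & ~ T a].
have fS : ~ S (f S) by move=> H; case: (H) => T /fI <-; apply.
by apply: (fS); exists S.
Qed.

Lemma nat_beth n : injects nat (beth n).
Proof.
elim: n => [|n IH]; first by exists id.
exact: injects_trans IH (injects_set1 _).
Qed.

(** This is how pairs and sequences of subsets of [A] are coded by one subset
of [A], by induction along the beth numbers. *)
Lemma injects_setM (A : Type) (B : countType) :
  injects nat A -> injects (A * A) A -> injects (set (B * A)) (set A).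
Proof.
move=> natA AA; apply: injects_set; apply: injects_trans AA.
apply: injects_pair; last by exists id.
exact: injects_trans (injects_countType _) natA.
Qed.

Lemma beth_square n : injects (beth n * beth n) (beth n).
Proof.
elim: n => [|n IH]; first exact: injects_countType.
apply: injects_trans (@injects_setM _ bool (nat_beth n) IH).
exists (fun p : set (beth n) * set (beth n) =>
  [set q : bool * beth n | if q.1 then p.1 q.2 else p.2 q.2]) => -[S T] [S' T'] /= eqST.
congr pair; apply/funext => a.
  by have := congr1 (@^~ (true, a)) eqST.
by have := congr1 (@^~ (false, a)) eqST.
Qed.

Lemma beth_pair n (A B : Type) :
  injects A (beth n) -> injects B (beth n) -> injects (A * B) (beth n).
Proof. by move=> An Bn; apply: injects_trans (injects_pair An Bn) (beth_square n). Qed.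

Lemma beth_countType n (C : countType) : injects C (beth n).
Proof. exact: injects_trans (injects_countType C) (nat_beth n). Qed.

(** A sequence of subsets of [A] is coded by its length and by the subset
of [nat * A] that lists its entries; the length distinguishes an empty entry from
a missing one. *)
Lemma beth_seq n : injects (seq (beth n)) (beth n).
Proof.
case: n => [|n]; first exact: (injects_countType (seq nat)).
have: injects (nat * set (nat * beth n)) (beth n.+1).
  apply: beth_pair (nat_beth _) _.
  exact: injects_setM (nat_beth n) (beth_square n).
apply: injects_trans.
exists (fun l : seq (set (beth n)) => (size l, [set q | nth set0 l q.1 q.2])).
move=> l l' [szl eql]; apply: (@eq_from_nth _ set0) => // i _.
by apply/funext => a; have := congr1 (@^~ (i, a)) eql.
Qed.

Lemma beth_omega_not_injects n : ~ injects beth_omega (beth n).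
Proof.
move=> h; apply: (@cantor (beth n)); apply: injects_trans h.
exists (fun S : beth n.+1 => existT beth n.+1 S) => S T eqST.
exact: (Eqdep_dec.inj_pair2_eq_dec _ (@eq_comparable nat) _ _ _ _ eqST).
Qed.

(** * Large separated families in the unit ball *)

Lemma card_le_injects (A B : Type) : ([set: A] #<= [set: B])%card -> injects A B.
Proof.
move=> /card_leP[f]; exists (fun a => val (f (to_setT a))) => a b /val_inj fab.
have /(congr1 val) := inj (mem_set I) (mem_set I) fab.
exact.
Qed.

Section separated.
Context (R : realType) (s : scalar_kind) (X : normedModType (scalars R s)).
Local Notation "r %:K" := (@of_real R s r) (at level 2, format "r %:K").

Let half : scalars R s := (2^-1)%:K.

Let two : 2%:K = 2 :> scalars R s.
Proof. by rewrite -[2 in LHS]/(1 + 1) of_realD of_real1. Qed.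

Let halfE : half = 2^-1.
Proof.
apply: (@mulfI _ (2 : scalars R s)); first by rewrite pnatr_eq0.
by rewrite divff ?pnatr_eq0// -two -of_realM divff ?pnatr_eq0 ?of_real1.
Qed.

Let nrm_half (x : X) : nrm (half *: x) = nrm x / 2.
Proof. by rewrite nrmZ nrm_of_real ger0_norm ?invr_ge0// mulrC. Qed.

Fixpoint dyadic_sum (K : Type) (e : K -> X) (l : seq K) : X :=
  if l is c :: l' then e c + half *: dyadic_sum e l' else 0.

(** If balls of radius 1/2 around the points [e c] cover the unit ball, then
doubling the remainder [x - e c] and approximating it again gains a factor 2 at
each step, so the finite sums [e c0 + (e c1 + ...) / 2] are dense in the unit
ball, and their multiples by powers of 2 are dense in the space. *)
Lemma dyadic_sum_dense (K : Type) (e : K -> X) :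
  (forall x, nrm x <= 1 -> exists c, nrm (x - e c) < 2^-1) ->
  dense (range (fun p : nat * seq K => 2 ^+ p.1 *: dyadic_sum e p.2)).
Proof.
move=> cover.
have nrm2 k (x : X) : nrm (2 ^+ k *: x) = 2 ^+ k * nrm x.
  elim: k => [|k IH]; first by rewrite !expr0 scale1r mul1r.
  by rewrite !exprS -scalerA nrmZ IH -two nrm_of_real normr_nat mulrA.
have approx k : forall x, nrm x <= 1 ->
    exists l, nrm (x - dyadic_sum e l) <= 2^-1 ^+ k.
  elim: k => [|k IH] x x1.
    by exists [::]; rewrite /= subr0 expr0.
  have [c xc] := cover x x1.
  have [|l lP] := IH (2 *: (x - e c)).
    rewrite -[2]expr1 nrm2 expr1 mulrC -ler_pdivlMr// mul1r; exact: ltW.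
  exists (c :: l); rewrite /= opprD addrA.
  have -> : x - e c = half *: (2 *: (x - e c)).
    by rewrite scalerA halfE mulVf ?pnatr_eq0// scale1r.
  by rewrite -scalerBr nrm_half exprSr ler_pM2r ?invr_gt0.
move=> O [x Ox] oO.
have /nbhs_ballP[eps /= eps0 xO] := open_nbhs_nbhs (conj oO Ox).
have epsE := of_real_ge0 (ltW eps0).
move: (@real_part R s eps) epsE => r epsE; subst eps.
have r0 : 0 < r by rewrite -(of_real_lt s) of_real0.
have pow (t : R) : exists m, t <= 2 ^+ m.
  exists (Num.bound `|t|); apply: (le_trans (ler_norm t)).
  rewrite (le_trans (ltW (archi_boundP (normr_ge0 t))))//.
  by rewrite -natrX ler_nat ltnW// ltn_expl.
have [m xm] := pow (nrm x).
have [k rk] := pow (2 ^+ m.+1 / r).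
have xE : x = 2 ^+ m *: (half ^+ m *: x).
  by rewrite scalerA -exprMn halfE mulfV ?pnatr_eq0// expr1n scale1r.
have [|l lP] := approx k (half ^+ m *: x).
  by move: xm; rewrite {1}xE nrm2 -ler_pdivlMl ?exprn_gt0// mulVf ?expf_neq0.
exists (2 ^+ m *: dyadic_sum e l); split; last by exists (m, l).
apply: xO; rewrite -ball_normE /= nrmE of_real_lt.
rewrite [in ltLHS]xE -scalerBr nrm2 (le_lt_trans (ler_wpM2l _ lP))// exprVn.
rewrite ltr_pdivrMr// mulrC -ltr_pdivrMr//.
apply: lt_le_trans rk; rewrite ltr_pM2r ?invr_gt0//.
by rewrite ltr_eXn2l// ltr1n.
Qed.

(** Zorn's lemma is applied to the partial injections from [beth n] to
1/2-separated subsets of the unit ball, seen as graphs. A maximal one that is not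
total cannot be extended, hence its values form a maximal 1/2-separated set, and
[dyadic_sum_dense] yields a dense set of cardinality at most [beth n]. *)
Lemma ball_separated (n : nat) : dens_ge beth_omega X ->
  exists x : beth n -> X, (forall c, nrm (x c) <= 1) /\
    forall c c', c <> c' -> 2^-1 <= nrm (x c - x c').
Proof.
move=> dens.
pose P (Gr : set (beth n * X)) := (forall p, Gr p -> nrm p.2 <= 1) /\
  forall p q, Gr p -> Gr q ->
    (p.1 = q.1 -> p.2 = q.2) /\ (p.1 <> q.1 -> 2^-1 <= nrm (p.2 - q.2)).
have [Gr [[Gr1 Gr2] Grmax]] : exists A, P A /\ forall B, A `<` B -> ~ P B.
  apply: Zorn_bigcup => F FP Ftot; split=> [p [A FA Ap]|p q [A FA Ap] [B FB Bq]].
    by have [+ _] := FP _ FA; exact.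
  have [AB|BA] := Ftot A B FA FB.
    by have [_] := FP _ FB; apply=> //; exact: AB.
  by have [_] := FP _ FA; apply=> //; exact: BA.
have [tot|] := pselect (forall c, exists x, Gr (c, x)).
  have [x xP] := choice tot; exists x; split=> [c|c c' cc'].
    exact: (Gr1 _ (xP c)).
  by have [_] := Gr2 _ _ (xP c) (xP c'); exact.
move=> /existsNP[c0 /forallNP noc0]; exfalso.
have cover x : nrm x <= 1 -> exists p, Gr p /\ nrm (x - p.2) < 2^-1.
  move=> x1; apply: contrapT => /forallNP far.
  have far' p : Gr p -> 2^-1 <= nrm (x - p.2).
    by move=> Grp; rewrite leNgt; apply/negP => xp; apply: (far p).
  (* A point far from all values extends the graph at the free index [c0]. *)
  apply: (Grmax (Gr `|` [set (c0, x)])).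
    split=> [p ?|sub]; first by left.
    by apply: (noc0 x); apply: sub; right.
  split=> [p [/Gr1//|->//]|p q [Grp|->] [Grq|->] /=]; first exact: Gr2.
  - split=> [pc0|_]; last by rewrite nrmC far'.
    by case: p Grp pc0 => c y /= Grp cc0; case: (noc0 y); rewrite -cc0.
  - split=> [pc0|_]; last by rewrite far'.
    by case: q Grq pc0 => c y /= Grq cc0; case: (noc0 y); rewrite cc0.
  - by split.
have /choice[e eP] : forall c, exists y, forall z, Gr (c, z) -> y = z.
  move=> c; have [[y cy]|no] := pselect (exists y, Gr (c, y)).
    by exists y => z cz; have [+ _] := Gr2 _ _ cy cz; exact.
  by exists 0 => z cz; case: no; exists z.
have /dyadic_sum_dense /dens small :
    forall x, nrm x <= 1 -> exists c, nrm (x - e c) < 2^-1.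
  move=> x /cover[[c y] [Grp xy]]; exists c.
  by rewrite (eP _ _ Grp).
apply: (@beth_omega_not_injects n).
apply: injects_trans (card_le_injects (card_le_trans small (card_image_le _ _))) _.
exact: beth_pair (nat_beth n) (beth_seq n).
Qed.

End separated.

(** * Maps from products of large sets to c0 spaces *)

Fixpoint tuples (B : nat -> Type) (n : nat) : Type :=
  if n is m.+1 then (tuples B m * B m)%type else unit.

(** Adjacency in the Hamming graph of the product, up to loops. *)
Fixpoint adjacent (B : nat -> Type) (n : nat) : tuples B n -> tuples B n -> Prop :=
  match n with
  | 0 => fun _ _ => False
  | m.+1 => fun a b =>
      a.1 = b.1 \/ (a.2 = b.2 /\ adjacent a.1 b.1)
  end.

Fixpoint everywhere_distinct (B : nat -> Type) (n : nat) :
    tuples B n -> tuples B n -> Prop :=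
  match n with
  | 0 => fun _ _ => True
  | m.+1 => fun a b => a.2 <> b.2 /\ everywhere_distinct a.1 b.1
  end.

(** Induction on [n]. For each value [c] of the last coordinate, the induction
hypothesis gives points [p], [q] of the remaining product with [F (p, c)] close to
[F (q, c)]. As there are more [c] than pairs, the same [p], [q] occur for two values
[c <> c'], and it remains to compare [F (p, c)] with [F (q, c')]. Let [W] be the
finite set of coordinates where [F (p, c0)] or [F (q, c0)] exceeds [L], for a fixed
[c0]. Off [W], moving the last coordinate from [c0] shows that [F (p, c)] and
[F (q, c')] are at most [2 L] in modulus. On [W], the pigeonhole principle also
makes the values of [F (q, c)] and [F (q, c')] agree up to [eta / 2], so that the
closeness of [F (p, c)] and [F (q, c)] carries over. The bound [4 L] therefore does not
accumulate with [n]; only the error [eta] does. *)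
Lemma distinct_pair_close (R : realType) (s : scalar_kind) (B : nat -> Type)
    (G : eqType) (L : R) :
  (forall n, ~ injects (B n) (tuples B n * tuples B n * seq (int * int))) ->
  0 < L ->
  forall n (F : tuples B n -> G -> scalars R s) (eta : R),
  0 < eta ->
  (forall a, finite_set [set g | L < nrm (F a g : scalars R s)]) ->
  (forall a b, adjacent a b -> forall g, nrm (F a g - F b g : scalars R s) <= L) ->
  exists p q, everywhere_distinct p q /\
    forall g, nrm (F p g - F q g : scalars R s) <= 4 * L + eta.
Proof.
move=> Bbig L0; elim=> [|n IH] F eta eta0 Ffin Flip.
  exists tt, tt; split=> // g.
  by rewrite subrr nrm0 addr_ge0 ?mulr_ge0 // ltW.
have eta20 : 0 < eta / 2 by rewrite divr_gt0.
have /choice[pq pqP] : forall c : B n, exists pq : tuples B n * tuples B n,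
    everywhere_distinct pq.1 pq.2 /\
    forall g, nrm (F (pq.1, c) g - F (pq.2, c) g : scalars R s) <= 4 * L + eta / 2.
  move=> c; have [a|a b ab g|p [q pqP]] := IH (fun a => F (a, c)) _ eta20.
  - exact: Ffin.
  - by apply: Flip; right.
  - by exists (p, q).
have [r rP] := scalar_rounding s eta20.
(* An empty last factor would inject into anything. *)
have [[c0 _]|noB] := pselect (exists c : B n, True); last first.
  exfalso; apply: (Bbig n); exists (fun c => False_rect _ (noB (ex_intro _ c I))).
  by move=> c; case: (noB (ex_intro _ c I)).
have /choice[U UP] : forall p : tuples B n, exists U : seq G,
    forall g, L < nrm (F (p, c0) g : scalars R s) -> g \in U.
  move=> p; have /finite_seqP[U UE] := Ffin (p, c0).
  by exists U => g gL; have : [set` U] g by rewrite -UE.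
pose W pq := U pq.1 ++ U pq.2.
pose color c := (pq c, [seq r (F ((pq c).2, c) g) | g <- W (pq c)]).
have [c [c' [cc' colc]]] : exists c c', c <> c' /\ color c = color c'.
  apply: contrapT => inj; apply: (Bbig n); exists color => c c' cc'.
  by apply: contrapT => ne; apply: inj; exists c, c'.
have [pqE roundE] : pq c = pq c' /\
    forall g, g \in W (pq c) ->
      r (F ((pq c).2, c) g) = r (F ((pq c).2, c') g).
  have := congr1 fst colc; rewrite /= => pqE; split=> //.
  have := congr1 snd colc; rewrite /= -pqE.
  by move=> /eq_in_map.
case: (pqP c) => pq_distinct pq_close.
exists ((pq c).1, c), ((pq c).2, c'); split=> // g.
(* On [W], compare with [F (q, c)]; off [W], both values are small. *)
have [gW|gW] := boolP (g \in W (pq c)).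
  rewrite -(subrK (F ((pq c).2, c) g) (F ((pq c).1, c) g)) -addrA.
  rewrite (le_trans (nrmD _ _))// [eta in leRHS]splitr addrA lerD//.
  by apply: rP; apply: roundE.
have small p : g \notin U p -> forall d, nrm (F (p, d) g : scalars R s) <= 2 * L.
  move=> gU d; rewrite -(subrK (F (p, c0) g) (F (p, d) g)).
  rewrite (le_trans (nrmD _ _))// mulrDl mul1r lerD//.
    by apply: Flip; left.
  by rewrite leNgt; apply: contra gU => /UP.
have -> : 4 * L + eta = 2 * L + 2 * L + eta by rewrite -mulrDl -natrD.
rewrite ler_wpDr ?(ltW eta0)// (le_trans (nrmB _ _))// lerD//.
  by apply: small; apply: contra gW => gU; rewrite mem_cat gU.
by apply: small; apply: contra gW => gU; rewrite mem_cat gU orbT.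
Qed.

(** * Coarse and uniform embeddings into c0 at a fixed scale *)

Section c0_embedding.
Context (R : realType) (s : scalar_kind).

Lemma c0_coord_le (Gamma : Type) (x y : c0 R s Gamma) g :
  nrm (x g - y g : scalars R s) <= c0_dist x y.
Proof.
have bounded (z : c0 R s Gamma) : exists M, forall g, nrm (z g : scalars R s) <= M.
  have /finite_seqP[l lE] := finite_image (fun h => nrm (z h : scalars R s))
    (c0_vanish z ltr01).
  exists (1 + \sum_(r <- l) `|r|) => h.
  have [zh|zh] := leP (nrm (z h : scalars R s)) 1.
    by rewrite (le_trans zh)// lerDl sumr_ge0.
  have hl : nrm (z h : scalars R s) \in l.
    by have : [set` l] (nrm (z h : scalars R s)) by rewrite -lE; exists h.
  rewrite ler_wpDl// (big_rem _ hl)/= (le_trans (ler_norm _))// lerDl.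
  exact: sumr_ge0.
have [Mx Mxle] := bounded x; have [My Myle] := bounded y.
apply: ub_le_sup; last by exists g.
exists (Mx + My) => _ [h _ <-]; rewrite (le_trans (nrmB _ _))//.
by rewrite lerD.
Qed.

Lemma c0_dist_le (Gamma : Type) (x y : c0 R s Gamma) (M : R) : 0 <= M ->
  (forall g, nrm (x g - y g : scalars R s) <= M) -> c0_dist x y <= M.
Proof.
move=> M0 xyM; have [[g _]|no] := pselect (exists g : Gamma, True).
  by apply: ge_sup; [exists (nrm (x g - y g : scalars R s)), g|move=> _ [h _ <-]].
rewrite /c0_dist.
have -> : range (fun g => nrm (x g - y g : scalars R s)) = set0; last by rewrite sup0.
by apply/seteqP; split=> // r [h]; case: no; exists h.
Qed.

(** A common consequence of the two kinds of embedding, and all that the proof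
uses of them. In the coarse case [delta] is 1, [L] is given by the expansion
modulus, and [M] is large. In the uniform case [M] is 1, [L] is small with respect
to the compression modulus at 1, and [delta] is chosen last. The factor 5 is the
constant 4 of [distinct_pair_close] with room for its error term. *)
Lemma embedding_scale (M1 Gamma : Type) (d : M1 -> M1 -> R) (f : M1 -> c0 R s Gamma) :
  coarse_embedding d (@c0_dist R s Gamma) f \/
  uniform_embedding d (@c0_dist R s Gamma) f ->
  exists delta L M : R, [/\ 0 < delta, 0 < L,
    (forall x y, d x y <= delta ->
       forall g, nrm (f x g - f y g : scalars R s) <= L) &
    (forall x y, (forall g, nrm (f x g - f y g : scalars R s) <= 5 * L) ->
       d x y <= M)].
Proof.
case=> [[fin infty]|[cont pos]].
- have [L L0 Lexp] : exists2 L : R, 0 < L &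
      (expansion_modulus d (@c0_dist R s Gamma) f 1 <= L%:E)%E.
    have := fin 1 ltr01; case: expansion_modulus => [r _|//|_].
      exists (Num.max r 1); first by rewrite lt_max ltr01 orbT.
      by rewrite lee_fin le_max lexx.
    by exists 1; rewrite ?leNye.
  have [M Mcomp] : exists M : R,
      ((5 * L)%:E < compression_modulus d (@c0_dist R s Gamma) f M)%E.
    have /cvgeyPgt /(_ (5 * L)) [M [_ Mgt]] := infty.
    by exists (M + 1); apply: Mgt; rewrite ltrDl.
  exists 1, L, M; split=> // [x y xy g|x y xy].
    apply: le_trans (c0_coord_le _ _ _) _; rewrite -lee_fin.
    by apply: le_trans Lexp; apply: ereal_sup_ubound; exists (x, y).
  rewrite leNgt; apply/negP => /ltW Mxy.
  have : ((5 * L)%:E < (5 * L)%:E)%E; last by rewrite ltxx.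
  apply: (lt_le_trans Mcomp).
  apply: (@le_trans _ _ (c0_dist (f x) (f y))%:E).
    by apply: ereal_inf_lbound; exists (x, y).
  by rewrite lee_fin c0_dist_le// mulr_ge0// ltW.
- have [L L0 Lcomp] : exists2 L : R, 0 < L &
      ((5 * L)%:E < compression_modulus d (@c0_dist R s Gamma) f 1)%E.
    have := pos 1 ltr01; case: compression_modulus => [r|_|//].
      rewrite lte_fin => r0.
      (* Any fraction of [r] below one fifth will do. *)
      exists (r / 10); first by rewrite divr_gt0.
      by rewrite lte_fin; lra.
    by exists 1; rewrite ?ltry.
  have [delta delta0 dexp] : exists2 delta : R, 0 < delta &
      (expansion_modulus d (@c0_dist R s Gamma) f delta <= L%:E)%E.
    have smallexp : \forall t \near (0 : R)^'+,
        (expansion_modulus d (@c0_dist R s Gamma) f t < L%:E)%E.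
      apply: (cont [set y | (y < L%:E)%E]); exact: lt_nbhsl.
    have [t [t0 tL]] := filter_ex (filterI (nbhs_right_gt (0 : R)) smallexp).
    by exists t => //; exact: ltW.
  exists delta, L, 1; split=> // [x y xy g|x y xy].
    apply: le_trans (c0_coord_le _ _ _) _; rewrite -lee_fin.
    by apply: le_trans dexp; apply: ereal_sup_ubound; exists (x, y).
  rewrite leNgt; apply/negP => /ltW Mxy.
  have : ((5 * L)%:E < (5 * L)%:E)%E; last by rewrite ltxx.
  apply: (lt_le_trans Lcomp).
  apply: (@le_trans _ _ (c0_dist (f x) (f y))%:E).
    by apply: ereal_inf_lbound; exists (x, y).
  by rewrite lee_fin c0_dist_le// mulr_ge0// ltW.
Qed.

End c0_embedding.

(** * James' distortion argument *)

Section james.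
Context (R : realType) (s : scalar_kind) (X : normedModType (scalars R s)).
Local Notation K := (scalars R s).
Local Notation "r %:K" := (@of_real R s r) (at level 2, format "r %:K").

Definition sup_dominated (I : finType) (M : R) (y : I -> X) : Prop :=
  forall a : I -> K, (forall i, nrm (a i) <= 1) ->
    nrm (\sum_i a i *: y i) <= M.

Lemma sup_dominated_scale (I : finType) (M : R) (y : I -> X) (t : R) (a : I -> K) :
  sup_dominated M y -> 0 <= t -> (forall i, nrm (a i) <= t) ->
  nrm (\sum_i a i *: y i) <= t * M.
Proof.
move=> yM; rewrite le_eqVlt => /predU1P[<-|t0] at_.
  rewrite mul0r big1 ?nrm0// => i _.
  by rewrite [a i]nrm0_eq0 ?scale0r//; apply/le_anti; rewrite at_ nrm_ge0.
have -> : \sum_i a i *: y i = t%:K *: \sum_i ((t^-1)%:K * a i) *: y i.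
  rewrite scaler_sumr; apply: eq_bigr => i _.
  by rewrite scalerA mulrA -of_realM divff ?gt_eqF// of_real1 mul1r.
rewrite nrmZ nrm_of_real gtr0_norm// ler_pM2l//; apply: yM => i.
by rewrite nrmM nrm_of_real gtr0_norm ?invr_gt0// mulrC ler_pdivrMr ?mul1r.
Qed.

(** The infimum of these constants is the quantity that cannot be improved by
passing to blocks; James' argument compares families with nearly optimal
constants with their own blocks. *)
Definition sup_constants : set R :=
  [set M | forall n, exists y : 'I_n -> X,
     (forall i, 1 <= nrm (y i)) /\ sup_dominated M y].

Lemma sup_constants_ge1 (M : R) : sup_constants M -> 1 <= M.
Proof.
move=> /(_ 1%N)[y [y1 yM]]; apply: le_trans (y1 ord0) _.
have := yM (fun=> 1); rewrite big_ord1 scale1r; apply => i.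
by rewrite -(of_real1 R s) nrm_of_real normr1.
Qed.

(** Let [k] be the infimum. A large family with a constant below [k + eta] is cut
into [n] blocks of length [m], where [m] is such that no family of length [m] has
the constant [k - eta]. Each block then has a combination, with coefficients of
modulus at most 1, of norm at least [k - eta], while the combinations together
inherit the constant of the whole family. *)
Lemma almost_isometric_family (n : nat) (eta : R) :
  0 < eta -> sup_constants !=set0 ->
  exists (w : 'I_n -> X) (M : R),
    [/\ sup_dominated M w, M < inf sup_constants + eta &
        forall i, inf sup_constants - eta <= nrm (w i)].
Proof.
move=> eta0 ne; have hinf : has_inf sup_constants.
  by split=> //; exists 1 => M; exact: sup_constants_ge1.
have [M SM Mlt] := inf_adherent eta0 hinf.
set k := inf sup_constants in Mlt *.
have /existsNP[m mP] : ~ sup_constants (k - eta).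
  by move=> /(ge_inf hinf.2); rewrite -/k; lra.
have block (y : 'I_m -> X) : (forall i, 1 <= nrm (y i)) ->
    exists a : 'I_m -> K, (forall i, nrm (a i) <= 1) /\
      k - eta <= nrm (\sum_i a i *: y i).
  move=> y1; apply: contrapT => no; apply: mP; exists y; split=> // a a1.
  by rewrite leNgt; apply/negP => /ltW alt; apply: no; exists a.
have [y [y1 yM]] := SM #|{: 'I_n * 'I_m}|.
have /choice[a aP] : forall i : 'I_n, exists a : 'I_m -> K,
    (forall j, nrm (a j) <= 1) /\
    k - eta <= nrm (\sum_j a j *: y (enum_rank (i, j))).
  by move=> i; apply: block.
exists (fun i => \sum_j a i j *: y (enum_rank (i, j))), M; split=> //.
- move=> b b1.
  have -> : \sum_i b i *: (\sum_j a i j *: y (enum_rank (i, j))) =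
      \sum_q (b (enum_val q).1 * a (enum_val q).1 (enum_val q).2) *: y q.
    rewrite (reindex (@enum_rank {: 'I_n * 'I_m})) /=; last first.
      by apply: onW_bij; exact: enum_rank_bij.
    under eq_bigr do rewrite scaler_sumr.
    rewrite pair_bigA; apply: eq_bigr => -[i j] _ /=.
    by rewrite enum_rankK scalerA.
  by apply: yM => q; rewrite nrmM mulr_ile1 ?nrm_ge0//; case: (aP (enum_val q).1).
- by move=> i; case: (aP i).
Qed.

(** The lower estimate comes for free from the upper one: if [b] is [a] with all
signs but the one at a largest coefficient [a i] reversed, then the sums for [a]
and [b] add up to [2 a_i w_i], and the sum for [b] has norm at most
[M * nrm (a i)]. *)
Lemma sup_dominated_lower (n : nat) (w : 'I_n -> X) (M k : R) (a : 'I_n -> K) i :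
  sup_dominated M w -> (forall j, k <= nrm (w j)) ->
  (forall j, nrm (a j) <= nrm (a i)) ->
  nrm (a i) * (2 * k - M) <= nrm (\sum_j a j *: w j).
Proof.
move=> wM wk amax.
pose b j := if j == i then a i else - a j.
have sumE : \sum_j a j *: w j + \sum_j b j *: w j = (a i + a i) *: w i.
  rewrite -big_split (bigD1 i) //= big1 ?addr0 => [|j ji].
    by rewrite /b eqxx scalerDl.
  by rewrite /b (negbTE ji) scaleNr subrr.
have bM : nrm (\sum_j b j *: w j) <= nrm (a i) * M.
  apply: sup_dominated_scale => // [|j]; first exact: nrm_ge0.
  by rewrite /b; case: eqP => // _; rewrite nrmN.
have low : nrm (a i) * k <= nrm (a i) * nrm (w i) by rewrite ler_wpM2l ?nrm_ge0.
have : nrm ((a i + a i) *: w i) <= nrm (\sum_j a j *: w j) + nrm (\sum_j b j *: w j).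
  by rewrite -sumE nrmD.
have -> : nrm ((a i + a i) *: w i) = 2 * (nrm (a i) * nrm (w i)).
  have -> : a i + a i = (2%:K : K) * a i.
    by rewrite -[2]/(1 + 1) of_realD of_real1 mulrDl mul1r.
  by rewrite nrmZ nrmM nrm_of_real ger0_norm// mulrA.
lra.
Qed.

Lemma nrm_row_coord (n : nat) (v : 'rV[K]_n) j : nrm (v ord0 j) <= nrm v.
Proof.
rewrite -(of_real_le s) -!nrmE -[leRHS]/(mx_norm v) mx_normE.
by rewrite -[leLHS]nngE num_le; exact: (le_bigmax _ _ (ord0, j)).
Qed.

Lemma nrm_row_attained (n : nat) (v : 'rV[K]_n) :
  v = 0 \/ exists j, nrm v = nrm (v ord0 j).
Proof.
have [/mx_norm_eq0|/mx_norm_neq0[[i j] vj]] := eqVneq (mx_norm v) 0; first by left.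
right; exists j; apply: (@of_real_inj R s); rewrite -!nrmE -[LHS]/(mx_norm v) vj.
by rewrite (ord1 i).
Qed.

Lemma linfty_of_family (n : nat) (w : 'I_n -> X) (M k C : R) :
  sup_dominated M w -> (forall j, k <= nrm (w j)) ->
  0 < 2 * k - M -> M <= C * (2 * k - M) ->
  exists (T : {linear 'rV[K]_n -> X}) (S : X -> 'rV[K]_n),
    cancel T S /\ (op_norm setT T * op_norm (range T) S <= C%:E)%E.
Proof.
move=> wM wk d0 MC.
pose T0 (v : 'rV[K]_n) : X := \sum_j v ord0 j *: w j.
have T0lin : linear T0.
  move=> c u v; rewrite /T0 scaler_sumr -big_split; apply: eq_bigr => j _ /=.
  by rewrite !mxE scalerDl scalerA.
pose TL := GRing.isLinear.Build K 'rV[K]_n X _ T0 T0lin.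
pose T : {linear 'rV[K]_n -> X} := HB.pack T0 TL.
have lower v : nrm v * (2 * k - M) <= nrm (T v).
  have [->|[j vj]] := nrm_row_attained v.
    by rewrite nrm0 mul0r nrm_ge0.
  rewrite vj; apply: sup_dominated_lower => // i.
  by rewrite -vj nrm_row_coord.
have Tinj : injective T.
  move=> u v uv; apply/eqP; rewrite -subr_eq0; apply/eqP/nrm0_eq0/le_anti.
  rewrite nrm_ge0 andbT -(ler_pM2r d0) mul0r (le_trans (lower _))//.
  by rewrite linearB uv subrr nrm0.
pose S x := xget 0 [set v | T v = x].
have TK : cancel T S.
  by move=> v; rewrite /S; case: xgetP => [u _ /Tinj//|/(_ v)]; case.
exists T, S; split=> //.
have opT : (op_norm setT T <= M%:E)%E.
  apply: ge_ereal_sup => _ [v [_ v1] <-]; rewrite lee_fin.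
  by apply: wM => j; rewrite (le_trans (nrm_row_coord _ _)).
have opS : (op_norm (range T) S <= ((2 * k - M)^-1)%:E)%E.
  apply: ge_ereal_sup => _ [_ [[v _ <-] v1] <-]; rewrite lee_fin TK.
  by rewrite -[leRHS]mul1r ler_pdivlMr// (le_trans (lower _)).
have op0 (V W : normedModType K) (D : set V) (f : V -> W) : D 0 ->
    (0 <= op_norm D f)%E.
  move=> D0; apply: (@le_trans _ _ (nrm (f 0))%:E).
    by rewrite lee_fin nrm_ge0.
  by apply: ereal_sup_ubound; exists 0 => //; split=> //; rewrite nrm0.
have T0_in : range T 0 by exists 0 => //; rewrite linear0.
apply: (le_trans (lee_pmul _ _ opT opS)).
- exact: op0.
- exact: op0.
- by rewrite -EFinM lee_fin ler_pdivrMr.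
Qed.

(** With the upper constant [M < k + eta] and the norms at least [k - eta], the
distortion is at most [(k + eta) / (2 (k - eta) - (k + eta))]. *)
Lemma james_distortion (C : R) :
  sup_constants !=set0 -> 1 < C -> contains_linfty_uniformly X C.
Proof.
move=> ne C1 n.
set k := inf sup_constants.
have k1 : 1 <= k.
  by apply: lb_le_inf => // M; exact: sup_constants_ge1.
(* The solution of [(1 + eta) (1 + C) = 2 C (1 - eta)], which makes the distortion
   at most [C] because [k >= 1]. *)
pose eta := (C - 1) / (1 + 3 * C).
have eta0 : 0 < eta by rewrite divr_gt0; lra.
have etaE : eta * (1 + 3 * C) = C - 1 by rewrite divfK// gt_eqF//; lra.
have [w [M [wM Mlt wk]]] := almost_isometric_family n eta0 ne.
rewrite -/k in Mlt wk.
have MC : M * (1 + C) <= 2 * C * (k - eta).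
  have : (k + eta) * (1 + C) <= 2 * C * (k - eta) by nra.
  apply: le_trans; rewrite ler_pM2r; lra.
have M0 : 0 <= M.
  have := wM (fun=> 0); rewrite big1 ?nrm0 => [|i _]; last by rewrite scale0r.
  by apply=> i; exact: ler01.
apply: (linfty_of_family wM wk); last by lra.
have k_eta : 0 < k - eta by nra.
have C10 : 0 < 1 + C by lra.
by rewrite -(pmulr_rgt0 _ C10); lra.
Qed.

End james.

(** * Vectors with bounded signed sums *)

Lemma tuples_beth n : injects (tuples (fun k => beth k.+1) n) (beth n).
Proof.
elim: n => [|n IH]; first exact: (beth_countType 0 unit).
apply: beth_pair; last by exists id.
exact: injects_trans IH (injects_set1 _).
Qed.

(** The cardinality hypothesis of [distinct_pair_close] for the factors
[beth 1, beth 2, ...]. *)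
Lemma beth_not_coloured n :
  ~ injects (beth n.+1)
      (tuples (fun k => beth k.+1) n * tuples (fun k => beth k.+1) n * seq (int * int)).
Proof.
move=> h; apply: (@cantor (beth n)); apply: injects_trans h _.
apply: beth_pair; last exact: (beth_countType n (seq (int * int))).
by apply: beth_pair; exact: tuples_beth.
Qed.

Section signs.
Context (R : realType) (s : scalar_kind) (X : normedModType (scalars R s)).
Local Notation K := (scalars R s).
Local Notation "r %:K" := (@of_real R s r) (at level 2, format "r %:K").

Definition signs_dominated (n : nat) (M : R) (y : nat -> X) : Prop :=
  forall e : nat -> bool, nrm (\sum_(i < n) (-1) ^+ e i *: y i) <= M.

Section signed_sums.
Context (B : nat -> Type) (x : forall k, B k -> X).
Hypothesis x_ball : forall k c, nrm (@x k c) <= 1.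
Hypothesis x_sep : forall k c c', c <> c' -> 2^-1 <= nrm (@x k c - x c').

Fixpoint signed_sum (e : nat -> bool) (n : nat) : tuples B n -> X :=
  match n with
  | 0 => fun _ => 0
  | m.+1 => fun a => signed_sum e a.1 + (-1) ^+ e m *: x a.2
  end.

Lemma signed_sum_adjacent e n (a b : tuples B n) :
  adjacent a b -> nrm (signed_sum e a - signed_sum e b) <= 2.
Proof.
elim: n a b => [//|n IH] [a c] [b d] /= [<-|[<- ab]]; last first.
  by rewrite opprD addrACA subrr addr0 IH.
rewrite opprD addrACA subrr add0r -scalerBr nrmZ_sign (le_trans (nrmB _ _))//.
by rewrite -[2]/(1 + 1) lerD.
Qed.

Lemma signed_sum_sub n (p q : tuples B n) : everywhere_distinct p q ->
  exists y : nat -> X, (forall i, (i < n)%N -> 2^-1 <= nrm (y i)) /\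
    forall e, signed_sum e p - signed_sum e q = \sum_(i < n) (-1) ^+ e i *: y i.
Proof.
elim: n p q => [|n IH] [] => [[] _|p c [q d] /= [cd pq]].
  by exists (fun=> 0); split=> // e; rewrite big_ord0 subrr.
have [y [y_ge yE]] := IH _ _ pq.
exists (fun i => if (i < n)%N then y i else x c - x d); split=> [i|e].
  rewrite ltnS leq_eqVlt => /predU1P[->|i_n]; last by rewrite i_n y_ge.
  by rewrite ltnn x_sep.
rewrite big_ord_recr /= ltnn opprD addrACA yE -scalerBr; congr (_ + _).
by apply: eq_bigr => i _; rewrite ltn_ord.
Qed.

End signed_sums.

(** The coordinates of [F a] are indexed by a sign pattern and an element of
[Gamma], so that one application of [distinct_pair_close] yields a pair of points
that works for all sign patterns together. The vectors are twice the differences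
of the coordinates of these points, which are at least 1/2 in norm. *)
Lemma bounded_signs (Gamma : Type) (f : X -> c0 R s Gamma) :
  dens_ge beth_omega X ->
  coarse_embedding (@nrm_dist R s X) (@c0_dist R s Gamma) f \/
  uniform_embedding (@nrm_dist R s X) (@c0_dist R s Gamma) f ->
  exists M, forall n, exists y : nat -> X,
    (forall i, (i < n)%N -> 1 <= nrm (y i)) /\ signs_dominated n M y.
Proof.
move=> dens /embedding_scale[delta [L [M [delta0 L0 fL fM]]]].
pose B k := beth k.+1.
have [x xP] : exists x : forall k, B k -> X, forall k,
    (forall c, nrm (x k c) <= 1) /\
    forall c c', c <> c' -> 2^-1 <= nrm (x k c - x k c').
  exists (fun k => sval (cid (ball_separated k.+1 dens))) => k.
  exact: (svalP (cid (ball_separated k.+1 dens))).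
pose t := delta / 2; have t0 : 0 < t by rewrite divr_gt0.
have nrmt (v : X) : nrm (t%:K *: v) = t * nrm v.
  by rewrite nrmZ nrm_of_real gtr0_norm.
exists (2 * (M / t)) => n.
pose F (a : tuples B n) (h : {classic n.-tuple bool * Gamma}) : K :=
  f (t%:K *: signed_sum x (nth false h.1) a) h.2.
have Ffin a : finite_set [set h | L < nrm (F a h : K)].
  pose S (e : n.-tuple bool) :=
    [set g | L < nrm (f (t%:K *: signed_sum x (nth false e) a) g : K)].
  apply: (@sub_finite_set _ _ (\bigcup_(e in [set: n.-tuple bool]) (pair e @` S e))).
    by move=> [e g] /= eg; exists e => //; exists g.
  apply: bigcup_finite => [|e _]; first exact: finite_finset.
  by apply: finite_image; exact: c0_vanish.
have Flip a b : adjacent a b -> forall h, nrm (F a h - F b h : K) <= L.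
  move=> ab h; apply: fL; rewrite /nrm_dist -scalerBr nrmt.
  have -> : delta = t * 2 by rewrite /t divfK.
  rewrite ler_pM2l//.
  by apply: signed_sum_adjacent => // k; case: (xP k).
have [p [q [pq close]]] := distinct_pair_close beth_not_coloured L0 L0 Ffin Flip.
have [y [y_ge yE]] := signed_sum_sub (fun k => (xP k).2) pq.
exists (fun i => 2%:K *: y i); split=> [i i_n|e].
  rewrite nrmZ nrm_of_real ger0_norm// mulrC -ler_pdivrMr// div1r.
  exact: y_ge.
have -> : \sum_(i < n) (-1) ^+ e i *: (2%:K *: y i) =
    2%:K *: \sum_(i < n) (-1) ^+ e i *: y i.
  by rewrite scaler_sumr; apply: eq_bigr => i _; rewrite !scalerA mulrC.
rewrite nrmZ nrm_of_real ger0_norm// ler_pM2l// ler_pdivlMr// mulrC.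
pose e' : n.-tuple bool := [tuple e i | i < n].
have -> : \sum_(i < n) (-1) ^+ e i *: y i =
    \sum_(i < n) (-1) ^+ nth false e' i *: y i.
  by apply: eq_bigr => i _; rewrite -tnth_nth tnth_mktuple.
rewrite -yE -nrmt scalerBr; apply: fM => g.
have -> : 5 * L = 4 * L + L by lra.
exact: (close (e', g)).
Qed.

(** The points [u + t z] with [-1 <= t <= 1] lie on the segment from [u - z]
to [u + z]. *)
Lemma nrm_segment (M t : R) (u z : X) :
  nrm (u + z) <= M -> nrm (u - z) <= M -> `|t| <= 1 -> nrm (u + t%:K *: z) <= M.
Proof.
move=> uz1 uz2; rewrite ler_norml => /andP[t1 t2].
pose c := (1 + t) / 2; pose d := (1 - t) / 2.
have c0 : 0 <= c by rewrite divr_ge0//; lra.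
have d0 : 0 <= d by rewrite divr_ge0//; lra.
have cd : c + d = 1 by rewrite /c /d; lra.
have -> : u + t%:K *: z = c%:K *: (u + z) + d%:K *: (u - z).
  rewrite !scalerDr addrACA -scalerDl -of_realD cd of_real1 scale1r.
  rewrite scalerN -scalerBl -of_realB; congr (_ + _%:K *: _).
  by rewrite /c /d; lra.
rewrite (le_trans (nrmD _ _))// !nrmZ !nrm_of_real !ger0_norm//.
by rewrite -[leRHS]mul1r -cd mulrDl lerD// ler_wpM2l.
Qed.

(** A ball that contains the vertices of a parallelepiped contains all of it. The
coordinates are released one at a time; [v] collects those already released. *)
Lemma signs_dominated_cube (n : nat) (M : R) (y : nat -> X) (v : X) :
  (forall e : nat -> bool, nrm (v + \sum_(i < n) (-1) ^+ e i *: y i) <= M) ->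
  forall a : nat -> R, (forall i, `|a i| <= 1) ->
    nrm (v + \sum_(i < n) (a i)%:K *: y i) <= M.
Proof.
elim: n v => [|n IH] v vM a a1.
  by have := vM xpredT; rewrite !big_ord0.
rewrite big_ord_recr /= [X in v + X]addrC addrA.
apply: IH => // e; rewrite addrAC; apply: nrm_segment => //.
  (* The two ends of the segment are the vertices that extend [e] by either
     sign at [n]. *)
  have := vM (fun i => (i < n)%N && e i).
  rewrite big_ord_recr /= ltnn expr0 scale1r addrA.
  by under eq_bigr do rewrite ltn_ord.
have := vM (fun i => (n <= i)%N || e i).
rewrite big_ord_recr /= leqnn expr1 scaleN1r addrA.
by under eq_bigr do rewrite leqNgt ltn_ord.
Qed.

(** Splitting complex coefficients into real and imaginary parts costs the
factor 2. *)
Lemma signs_dominated_sup (n : nat) (M : R) (y : nat -> X) :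
  signs_dominated n M y -> sup_dominated (2 * M) (fun i : 'I_n => y i).
Proof.
move=> yM a a1; have [j [j1 dec]] := scalar_decomp R s.
have cube (b : 'I_n -> R) : (forall i, `|b i| <= 1) ->
    nrm (\sum_(i < n) (b i)%:K *: y i) <= M.
  move=> b1; pose b' k := oapp b 0 (insub k).
  have := @signs_dominated_cube n M y 0 _ b' _; rewrite add0r.
  under eq_bigr do rewrite /b' valK /=.
  apply=> [e|k]; first by rewrite add0r.
  by rewrite /b'; case: insubP => //= _; rewrite normr0.
have /choice[b bP] : forall i, exists b : R * R,
    [/\ a i = b.1%:K + j * b.2%:K, `|b.1| <= 1 & `|b.2| <= 1].
  move=> i; have [b1 [b2 [ab l1 l2]]] := dec (a i).
  by exists (b1, b2); split=> //=; exact: le_trans (a1 i).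
have -> : \sum_i a i *: y i =
    \sum_i (b i).1%:K *: y i + j *: \sum_i (b i).2%:K *: y i.
  rewrite scaler_sumr -big_split; apply: eq_bigr => i _ /=.
  by case: (bP i) => {1}-> _ _; rewrite scalerDl scalerA.
rewrite (le_trans (nrmD _ _))// nrmZ mulrDl mul1r lerD//.
  by apply: cube => i; case: (bP i).
by rewrite -[leRHS]mul1r ler_pM ?nrm_ge0// cube// => i; case: (bP i).
Qed.

(** The Rademacher average of the [n] vectors is at most [M], while cotype [q]
bounds it below by a multiple of [n ^ (1/q)]. *)
Lemma signs_dominated_no_cotype (M : R) :
  (forall n, exists y : nat -> X,
    (forall i, (i < n)%N -> 1 <= nrm (y i)) /\ signs_dominated n M y) ->
  ~ nontrivial_cotype X.
Proof.
move=> fam [q q2 [C C0 cot]].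
have q0 : 0 < q by lra.
have M0 : 0 <= M.
  have [y [_ /(_ xpredT)]] := fam 0%N; exact: le_trans (nrm_ge0 _).
have bound n : n%:R <= (C * M) `^ q.
  have [y [y1 yM]] := fam n.
  have sum_ge : n%:R <= \sum_(i < n) nrm (y i) `^ q.
    rewrite -[n in leLHS]card_ord -sumr_const ler_sum// => i _.
    have <- : 1 `^ q = 1 :> R by rewrite powR1.
    by rewrite ge0_ler_powR ?nnegrE ?nrm_ge0 ?y1// ltW.
  have := cot n (fun i => y i).
  set S := \sum_(i < n) _ in sum_ge *; set A := \sum_(eps : {ffun _}) _ => SA.
  have S0 : 0 <= S by rewrite (le_trans _ sum_ge).
  have A_le : A <= M ^+ 2 *+ 2 ^ n.
    rewrite -[X in _ *+ X ^ _]card_bool -[X in _ *+ _ ^ X]card_ord -card_ffun -sumr_const.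
    apply: ler_sum => eps _; rewrite lerXn2r ?nnegrE ?nrm_ge0//.
    have := yM (fun k => oapp eps false (insub k)).
    by under eq_bigr do rewrite valK /=.
  rewrite (le_trans sum_ge)//.
  have -> : S = (S `^ q^-1) `^ q by rewrite -powRrM mulVf ?powRr1// gt_eqF.
  rewrite ge0_ler_powR ?nnegrE ?powR_ge0 ?mulr_ge0 ?(ltW q0) ?(ltW C0)//.
  rewrite (le_trans SA)// ler_pM2l// -[leRHS]ger0_norm// -sqrtr_sqr ler_wsqrtr//.
  rewrite mulrC ler_pdivrMr ?exprn_gt0// (le_trans A_le)//.
  by rewrite -mulr_natr natrX.
have := archi_boundP (powR_ge0 (C * M) q).
by rewrite ltNge bound.
Qed.

End signs.

Theorem theoremA (R : realType) (s : scalar_kind)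
    (X : completeNormedModType (scalars R s))
    (hdens : dens_ge beth_omega X)
    (hemb : exists (Gamma : Type) (f : X -> c0 R s Gamma),
        coarse_embedding (@nrm_dist R s X) (@c0_dist R s Gamma) f \/
        uniform_embedding (@nrm_dist R s X) (@c0_dist R s Gamma) f) :
  ~ nontrivial_cotype X /\
  (exists C : R, 1 < C /\ contains_linfty_uniformly X C) /\
  (forall C : R, 1 < C -> contains_linfty_uniformly X C).
Proof.
have [Gamma [f /(bounded_signs hdens)[M fam]]] := hemb.
have ne : sup_constants X !=set0.
  exists (2 * M) => n; have [y [y1 yM]] := fam n.
  exists (fun i => y i); split=> [i|]; first exact: y1.
  exact: signs_dominated_sup.
split; first exact: signs_dominated_no_cotype fam.
split=> [|C]; last exact: james_distortion.
by exists 2; split; [rewrite ltr1n|apply: james_distortion; rewrite ?ltr1n].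
Qed.
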